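(* Let $A=\mathrm{diag}(a_1,\dots,a_{n-1},\pm a_n)\in\mathbb{R}^{n\times n}$ (either choice of sign) where $a_1>\cdots>a_n\ge 0$, and let $P=p_1I_{n_1}\oplus\cdots\oplus p_kI_{n_k}$ where $p_1>\cdots>p_k\ge 0$, the $n_i$ are positive integers and $n_1+\cdots+n_k=n$. Then: (i) if $p_k>0$, $$\mathcal{G}_P(A)=\{(U_1\oplus\cdots\oplus U_k)\,A\,(U_1^t\oplus\cdots\oplus U_k^t):U_i\in\mathrm{SO}_{n_i},\ i=1,\dots,k\};$$ (ii) if $p_k=0$, $$\mathcal{G}_P(A)=\{(U_1\oplus\cdots\oplus U_{k-1}\oplus U)\,A\,(U_1^t\oplus\cdots\oplus U_{k-1}^t\oplus V):U_i\in\mathrm{SO}_{n_i},\ i=1,\dots,k-1,\ U,V\in\mathrm{SO}_{n_k}\}.$$ In both cases, $\mathcal{G}_P(A)$ is path connected.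
   Context: $\mathrm{SO}_n=\{U\in\mathbb{R}^{n\times n}:U^tU=UU^t=I_n,\ \det U>0\}$, and $O(A)=\{UAV:U,V\in\mathrm{SO}_n\}$ for $A\in\mathbb{R}^{n\times n}$. For $P,A\in\mathbb{R}^{n\times n}$, $r(P,A)=\max\{\mathrm{tr}(PUAV):U,V\in\mathrm{SO}_n\}$ and $\mathcal{G}_P(A)=\{B\in O(A):\mathrm{tr}(PB)=r(P,A)\}$. The symbol $X\oplus Y$ denotes the block-diagonal matrix with diagonal blocks $X$ and $Y$. *)

(* Defs.v *)
From mathcomp Require Export all_boot all_order all_algebra.
From mathcomp Require Export all_classical all_reals all_analysis.
Set Implicit Arguments.
Unset Strict Implicit.
Unset Printing Implicit Defensive.
Import Order.TTheory GRing.Theory Num.Theory.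
Import numFieldNormedType.Exports.
Local Open Scope classical_set_scope.
Local Open Scope ring_scope.

Definition SO (R : realType) (n : nat) : set 'M[R]_n :=
  [set U | [/\ U^T *m U = 1%:M, U *m U^T = 1%:M & 0 < \det U]].

Definition SOorbit (R : realType) (n : nat) (A : 'M[R]_n) : set 'M[R]_n :=
  [set B | exists U V, [/\ SO U, SO V & B = U *m A *m V]].

(* The junk value 0 (no maximum) is irrelevant for [rmax] below, where SO(n)
   is compact, so the maximum exists. *)
Definition set_max (R : realType) (S : set R) : R := xget 0 (S `&` ubound S).

Definition rmax (R : realType) (n : nat) (P A : 'M[R]_n) : R :=
  set_max [set x | exists U V, [/\ SO U, SO V & x = \tr (P *m U *m A *m V)]].

Definition GP (R : realType) (n : nat) (P A : 'M[R]_n) : set 'M[R]_n :=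
  [set B | SOorbit A B /\ \tr (P *m B) = rmax P A].

(* diag(a_1, ..., a_(n-1), (-1)^b a_n) *)
Definition sdiag (R : realType) (n : nat) (b : bool) (a : 'I_n -> R) :
    'M[R]_n :=
  diag_mx (\row_j (if j.+1 == n then (-1) ^+ b * a j else a j)).

(* Nonemptiness is not required. *)
Definition path_connected (R : realType) (T : topologicalType) (S : set T) :=
  forall x y, S x -> S y -> exists f : R -> T,
    [/\ {within `[0, 1], continuous f}, f 0 = x, f 1 = y &
        forall t, t \in `[0, 1] -> S (f t)].

(* Main.v *)
Require Import Defs.
From mathcomp Require Import ring lra.
Set Implicit Arguments.
Unset Strict Implicit.
Unset Printing Implicit Defensive.
Import Order.TTheory GRing.Theory Num.Theory.
Import numFieldNormedType.Exports.
Local Open Scope classical_set_scope.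
Local Open Scope ring_scope.

(** Write [w s] for the diagonal entry of [P] in row [s], lowered by the last
    value [p_k], and split
      [tr (P U A V) = tr ((P - p_k) U A V) + p_k tr (A (V U))].
    Each summand is at most its value at [U = V = 1], so the maximum is
    [tr (P A)] and a maximizer must be optimal for the first summand, and also
    for the second one when [p_k > 0].

    The first summand is bilinear in the products [U s j * V j s], which the
    arithmetic-geometric inequality bounds by the entries of the doubly
    stochastic matrix [(U s j ^ 2 + V j s ^ 2) / 2].  The rearrangement
    inequality for doubly stochastic matrices is proved by linear programming
    duality: an explicit dual solution ([trapezoid_potential]) is tight exactly
    at the pairs [(s, j)] with [w s = w j].  By complementary slackness
    ([weighted_trace_max]) an optimal pair is supported on the diagonal blocks,
    and [V] agrees with [U^T] on every block whose weight is nonzero.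

    For the second summand, [tr (A W) <= tr A] for [W] in [SO n], with equality
    only at [W = 1] ([SO_trace_sdiag_max]).  When the last entry of [A] is
    negative this rests on the fact that an orthogonal matrix of determinant
    [-1] has trace at most [n - 2].  Hence [V = U^T] as soon as [p_k > 0].

    The blocks obtained so far are only orthogonal.  Multiplying them by
    diagonal sign matrices, which commute with [A], makes every determinant
    equal to [1] without changing [U A V] ([SO_blocks_sign_fix]).  Both cases of
    the theorem thereby become the single description [GP_blocks], in which the
    [i]-th blocks are transposes of each other whenever [p_i <> 0].

    That description parametrizes the maximizers continuously by a product of
    special orthogonal groups, so it remains to see that [SO n] is path
    connected ([SO_pathP]).  Every element of [SO n] is a product of pairs of
    Householder reflections, and a pair [H_u H_v] is joined to
    [H_u H_u = 1] by moving [v] to [u] along a line that avoids the origin. *)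

(** * Orthogonal matrices *)

Section Orthogonal.
Variables (R : realType) (n : nat).
Implicit Types U V : 'M[R]_n.

Definition orthogonal_mx U := U^T *m U = 1%:M.

Lemma orthogonal_mxT U : orthogonal_mx U -> orthogonal_mx U^T.
Proof. by move=> /mulmx1C; rewrite /orthogonal_mx trmxK. Qed.

Lemma orthogonal_mxM U V :
  orthogonal_mx U -> orthogonal_mx V -> orthogonal_mx (U *m V).
Proof.
move=> oU oV; rewrite /orthogonal_mx trmx_mul mulmxA -(mulmxA V^T).
by rewrite oU mulmx1.
Qed.

Lemma orthogonal_mx1 : orthogonal_mx 1%:M.
Proof. by rewrite /orthogonal_mx trmx1 mulmx1. Qed.

Lemma det_orthogonal_mx U : orthogonal_mx U -> \det U * \det U = 1.
Proof. by move=> oU; rewrite -{1}(det_tr U) -det_mulmx oU det1. Qed.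

Lemma orthogonal_mx_col U j : orthogonal_mx U -> \sum_i U i j ^+ 2 = 1.
Proof.
move=> /matrixP /(_ j j); rewrite !mxE eqxx mulr1n => <-.
by apply: eq_bigr => i _; rewrite !mxE expr2.
Qed.

Lemma SOP U : SO U <-> orthogonal_mx U /\ \det U = 1.
Proof.
split=> [[oU _ dU]|[oU dU]]; last by split=> //; [exact: mulmx1C|rewrite dU].
split=> //; have := det_orthogonal_mx oU => d2.
have : (\det U - 1) * (\det U + 1) = 0 by rewrite -subr_sqr expr1n expr2 d2 subrr.
move/eqP; rewrite mulf_eq0 subr_eq0 => /orP[/eqP//|/eqP d0]; lra.
Qed.

Lemma SOM U V : SO U -> SO V -> SO (U *m V).
Proof.
move=> /SOP[oU dU] /SOP[oV dV]; apply/SOP; split; first exact: orthogonal_mxM.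
by rewrite det_mulmx dU dV mulr1.
Qed.

Lemma SOT U : SO U -> SO U^T.
Proof.
by move=> /SOP[oU dU]; apply/SOP; rewrite det_tr; split=> //; exact: orthogonal_mxT.
Qed.

Lemma SO1 : SO (1%:M : 'M[R]_n).
Proof. by apply/SOP; rewrite det1; split=> //; exact: orthogonal_mx1. Qed.

End Orthogonal.

Lemma orthogonal_mx_row (R : realType) n (U : 'M[R]_n) i :
  orthogonal_mx U -> \sum_j U i j ^+ 2 = 1.
Proof.
move=> /orthogonal_mxT /orthogonal_mx_col -/(_ i) <-.
by apply: eq_bigr => j _; rewrite mxE.
Qed.

Lemma orthogonal_mx_entry_le1 (R : realType) n (U : 'M[R]_n) i j :
  orthogonal_mx U -> U i j <= 1.
Proof.
move=> /orthogonal_mx_row -/(_ i); rewrite (bigD1 j)//= => e.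
have : 0 <= \sum_(k | k != j) U i k ^+ 2 by apply: sumr_ge0 => k _; exact: sqr_ge0.
by move=> h; nra.
Qed.

(** An entry equal to [1] already exhausts the unit norm of its row. *)
Lemma orthogonal_mx_entry1 (R : realType) n (U : 'M[R]_n) i j :
  orthogonal_mx U -> U i j = 1 -> forall k, k != j -> U i k = 0.
Proof.
move=> /orthogonal_mx_row -/(_ i); rewrite (bigD1 j)//= => e u1 k kj.
move: e; rewrite u1 expr1n => /eqP; rewrite -subr_eq0 addrAC subrr add0r.
rewrite psumr_eq0; last by move=> ? _; exact: sqr_ge0.
by move=> /allP /(_ k (mem_index_enum _)); rewrite kj sqrf_eq0 => /eqP.
Qed.

(** * A dual solution for the rearrangement inequality *)

Section Trapezoid.
Variables (R : realType) (n : nat) (w a : nat -> R).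
Hypothesis w_decr : forall i j, (i <= j)%N -> (j < n)%N -> w j <= w i.
Hypothesis a_decr : forall i, (i.+1 < n)%N -> a i.+1 < a i.

(* [beta] is the integral of [w] against [da] by the trapezoidal rule.  Any
   value between [w l] and [w l.+1] on the step from [l] to [l.+1] would give
   the inequalities; the midpoint makes them strict in both directions when
   the two weights differ. *)
Let beta k := \sum_(l < k) 2^-1 * (w l + w l.+1) * (a l.+1 - a l).

Let betaS k : beta k.+1 = beta k + 2^-1 * (w k + w k.+1) * (a k.+1 - a k).
Proof. by rewrite /beta big_ord_recr. Qed.

Let potential_up s d : (s + d < n)%N ->
  w s * a (s + d) - beta (s + d) <= w s * a s - beta s
    ?= iff (w s == w (s + d)).
Proof.
elim: d => [|d IH]; rewrite ?addn0 ?eqxx ?addnS => h; first by apply/leifP; rewrite eqxx.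
have wd := @w_decr s (s + d) (leq_addr _ _) (ltnW h).
have wd1 := @w_decr (s + d) (s + d).+1 (leqnSn _) h.
have ad := a_decr h; rewrite betaS; have {IH} := IH (ltnW h).
have [e1 [_ IH]|ne1 [IH _]] := eqVneq (w s) (w (s + d).+1); apply/leifP.
  have e2 : w (s + d)%N = w s by apply/eqP; rewrite eq_le wd e1 wd1.
  by move: IH; rewrite -e1 e2 !eqxx => /eqP IH; apply/eqP; lra.
suff : 0 < (w s - 2^-1 * (w (s + d) + w (s + d).+1)) * (a (s + d) - a (s + d).+1)
  by lra.
by apply: mulr_gt0; [move: ne1; rewrite neq_lt => /orP[]; lra|lra].
Qed.

Let potential_down d s : (s + d < n)%N ->
  w (s + d) * a s - beta s <= w (s + d) * a (s + d) - beta (s + d)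
    ?= iff (w (s + d) == w s).
Proof.
elim: d s => [|d IH] s; rewrite ?addn0 ?eqxx ?addnS => h; first by apply/leifP; rewrite eqxx.
have wd := @w_decr s s.+1 (leqnSn _) (leq_ltn_trans (leq_addr d s.+1) h).
have wd1 := @w_decr s.+1 (s + d).+1 (leq_addr d s.+1) h.
have ad := a_decr (leq_ltn_trans (leq_addr d s.+1) h).
have {IH} := IH s.+1 h; rewrite addSn betaS.
have [e1 [_ IH]|ne1 [IH _]] := eqVneq (w (s + d).+1) (w s); apply/leifP.
  have e2 : w s.+1 = w (s + d).+1 by apply/eqP; rewrite eq_le wd1 e1 wd.
  by move: IH; rewrite -e1 e2 !eqxx => /eqP IH; apply/eqP; lra.
suff : 0 < (2^-1 * (w s + w s.+1) - w (s + d).+1) * (a s - a s.+1) by lra.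
by apply: mulr_gt0; [move: ne1; rewrite neq_lt => /orP[]; lra|lra].
Qed.

Lemma trapezoid_potential_nat : exists beta : nat -> R, forall s j,
  (s < n)%N -> (j < n)%N ->
  w s * a j - beta j <= w s * a s - beta s ?= iff (w s == w j).
Proof.
exists beta => s j sn jn; have [sj|/ltnW js] := leqP s j.
  by rewrite -(subnKC sj) in jn *; exact: potential_up.
by rewrite -(subnKC js) in sn *; exact: potential_down.
Qed.

End Trapezoid.

(** With [alpha s := w s * a s - beta s] this says that [(alpha, beta)] is
    feasible for the dual of the assignment problem with profits [w s * a j],
    since [w s * a j <= alpha s + beta j], that it is tight on the diagonal, so
    the identity assignment is optimal, and that it is tight elsewhere only
    between equal weights. *)
Lemma trapezoid_potential (R : realType) n (w a : 'I_n -> R)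
    (w_decr : forall i j : 'I_n, (i <= j)%N -> w j <= w i)
    (a_decr : forall i j : 'I_n, (i < j)%N -> a j < a i) :
  exists beta : 'I_n -> R, forall s j,
    w s * a j - beta j <= w s * a s - beta s ?= iff (w s == w j).
Proof.
case: n w a w_decr a_decr => [|n] w a w_decr a_decr; first by exists a => -[].
have [|i|beta hb] := @trapezoid_potential_nat R n.+1 (w \o inord) (a \o inord).
- move=> i j ij jn; apply: w_decr.
  by rewrite !inordK// (leq_ltn_trans ij).
- by move=> h; apply: a_decr; rewrite !inordK// ltnW.
exists (beta \o val) => s j; have := hb s j (ltn_ord s) (ltn_ord j).
by rewrite /= !inord_val.
Qed.

(** * The weighted trace inequality and its equality case *)

Section Rearrangement.
Variables (R : realType) (n : nat) (w a a' : 'I_n -> R).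
Hypothesis w_ge0 : forall i, 0 <= w i.
Hypothesis w_decr : forall i j : 'I_n, (i <= j)%N -> w j <= w i.
Hypothesis a_decr : forall i j : 'I_n, (i < j)%N -> a j < a i.
Hypothesis a'_abs : forall i, `|a' i| = a i.
Hypothesis a'_gt0 : forall i, w i != 0 -> 0 < a' i.

Variables U V : 'M[R]_n.
Hypotheses (oU : orthogonal_mx U) (oV : orthogonal_mx V).

(* [Y] is doubly stochastic because [U] and [V] are orthogonal. *)
Let Y s j := 2^-1 * (U s j ^+ 2 + V j s ^+ 2).

Let Y_ge0 s j : 0 <= Y s j.
Proof. by rewrite mulr_ge0 ?invr_ge0// addr_ge0 ?sqr_ge0. Qed.

Let Y_row s : \sum_j Y s j = 1.
Proof.
rewrite -mulr_sumr big_split/= orthogonal_mx_row// orthogonal_mx_col//; lra.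
Qed.

Let Y_col j : \sum_s Y s j = 1.
Proof.
rewrite -mulr_sumr big_split/= orthogonal_mx_row// orthogonal_mx_col//; lra.
Qed.

Let value_le s j : w s * a' j * (U s j * V j s) <= w s * a j * Y s j.
Proof.
rewrite -!mulrA; apply: ler_wpM2l => //; rewrite mulrA -a'_abs.
have := sqr_ge0 (U s j - V j s); have := sqr_ge0 (U s j + V j s).
rewrite /Y; have [?|?] := ger0P (a' j); nra.
Qed.

(** Weak duality and complementary slackness.  The difference between the two
    sides is a sum of nonnegative terms [slack s j], each of them the dual gap at
    [(s, j)] weighted by [Y s j], plus the loss in the arithmetic-geometric
    inequality.  At equality all of them vanish: the gap is positive across
    different weights, which forces [Y s j = 0] there, and wherever
    [w s * a j] is positive the arithmetic-geometric inequality is an equality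
    only if [U s j = V j s]. *)
Lemma weighted_trace_max :
  let value := \sum_s \sum_j w s * a' j * (U s j * V j s) in
  let optimum := \sum_s w s * a' s in
  value <= optimum /\
  (value = optimum -> forall s j,
     (w s != w j -> U s j = 0 /\ V j s = 0) /\ (w s != 0 -> U s j = V j s)).
Proof.
move=> value optimum.
have [beta hbeta] := trapezoid_potential w_decr a_decr.
pose alpha s := w s * a s - beta s.
have wa s : w s * a' s = w s * a s.
  have [->|/a'_gt0 /ltW ?] := eqVneq (w s) 0; first by rewrite !mul0r.
  by rewrite -a'_abs ger0_norm.
pose slack s j := (alpha s + beta j - w s * a j) * Y s j
  + (w s * a j * Y s j - w s * a' j * (U s j * V j s)).
have gap_ge0 s j : 0 <= alpha s + beta j - w s * a j.
  by have [h _] := hbeta s j; rewrite /alpha; lra.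
have fst_ge0 s j : 0 <= (alpha s + beta j - w s * a j) * Y s j by rewrite mulr_ge0.
have snd_ge0 s j : 0 <= w s * a j * Y s j - w s * a' j * (U s j * V j s).
  by rewrite subr_ge0.
have slack_ge0 s j : 0 <= slack s j by rewrite addr_ge0.
have slack_sum : \sum_s \sum_j slack s j = optimum - value.
  rewrite [in RHS]/value -sumrN.
  have -> : optimum = \sum_s (alpha s + beta s).
    by apply: eq_bigr => s _; rewrite wa /alpha subrK.
  have -> : \sum_s (alpha s + beta s) = \sum_s \sum_j (alpha s + beta j) * Y s j.
    under [RHS]eq_bigr do under eq_bigr do rewrite mulrDl.
    under [RHS]eq_bigr do rewrite big_split/= -mulr_sumr Y_row mulr1.
    rewrite !big_split/=; congr (_ + _); rewrite exchange_big/=.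
    by apply: eq_bigr => j _; rewrite -mulr_sumr Y_col mulr1.
  rewrite -big_split/=; apply: eq_bigr => s _.
  rewrite -sumrN -big_split/=; apply: eq_bigr => j _.
  by rewrite /slack; ring.
split; first by rewrite -subr_ge0 -slack_sum; do 2!apply: sumr_ge0 => ? _.
move=> e s j.
have : slack s j = 0.
  move: slack_sum; rewrite e subrr => /eqP; rewrite psumr_eq0; last first.
    by move=> ? _; apply: sumr_ge0.
  move=> /allP /(_ s (mem_index_enum _)) /=; rewrite psumr_eq0 //.
  by move=> /allP /(_ j (mem_index_enum _)) /= /eqP.
move/eqP; rewrite paddr_eq0 // mulf_eq0 => /andP[/orP gapY /eqP val0].
have Y0 : w s != w j -> Y s j = 0.
  move=> wsj; case: gapY => /eqP // g0; have [_ ] := hbeta s j.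
  by rewrite (negbTE wsj) => /negbT/eqP[]; rewrite /alpha in g0; lra.
have UV0 : w s != w j -> U s j = 0 /\ V j s = 0.
  move=> /Y0 /eqP; rewrite mulf_eq0 invr_eq0 pnatr_eq0/= paddr_eq0 ?sqr_ge0//.
  by rewrite !sqrf_eq0 => /andP[/eqP-> /eqP->].
split=> // ws0; have [wsj|/UV0[-> ->]//] := eqVneq (w s) (w j).
have aj : 0 < a' j by apply: a'_gt0; rewrite -wsj.
move: val0; rewrite -a'_abs gtr0_norm//= -mulrBr => /eqP.
rewrite !mulf_eq0 (negbTE ws0) gt_eqF//= => /eqP e0; apply/eqP.
by rewrite -subr_eq0 -sqrf_eq0; apply/eqP; rewrite /Y in e0; lra.
Qed.

End Rearrangement.

(** * The trace of a signed diagonal matrix times a rotation *)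

Lemma ltn_ord_max n (j : 'I_n.+1) : j != ord_max -> (j < (ord_max : 'I_n.+1))%N.
Proof. by move=> jm; rewrite ltn_neqAle leq_ord andbT. Qed.

Section Reflections.
Variables (R : realType) (n : nat).
Implicit Types (u v : 'rV[R]_n) (W : 'M[R]_n).

Definition sqnorm v : R := \sum_j v 0 j ^+ 2.

Lemma mul_row_tr v : v *m v^T = (sqnorm v)%:M.
Proof.
rewrite [LHS]mx11_scalar; congr _%:M; rewrite mxE.
by apply: eq_bigr => j _; rewrite mxE expr2.
Qed.

Lemma sqnorm_eq0 v : (sqnorm v == 0) = (v == 0).
Proof.
apply/eqP/eqP => [|->]; last by rewrite /sqnorm big1// => j _; rewrite mxE expr0n.
move=> /eqP; rewrite psumr_eq0 => [|j _]; last exact: sqr_ge0.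
move=> /allP h; apply/rowP => j; rewrite mxE; apply/eqP.
by rewrite -sqrf_eq0; exact: (h j (mem_index_enum _)).
Qed.

Lemma trace_outer v : \tr (v^T *m v) = sqnorm v.
Proof. by rewrite mxtrace_mulC mul_row_tr mxtrace_scalar. Qed.

Lemma outer_outer v : v^T *m v *m (v^T *m v) = sqnorm v *: (v^T *m v).
Proof. by rewrite mulmxA -(mulmxA v^T) mul_row_tr mul_mx_scalar scalemxAl. Qed.

Lemma orthogonal_trace_le W : orthogonal_mx W -> \tr W <= n%:R.
Proof.
move=> oW; rewrite -[X in _ <= X%:R]card_ord -sumr_const; apply: ler_sum => i _.
exact: orthogonal_mx_entry_le1.
Qed.

(** Such a [W] has an eigenvector [v] with eigenvalue [-1].  Flipping that
    eigenvalue to [1] adds [2] to the trace and gives an orthogonal matrix, whose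
    trace is at most [n]. *)
Lemma orthogonal_trace_le_neg W :
  orthogonal_mx W -> \det W = -1 -> \tr W <= n%:R - 2.
Proof.
move=> oW dW.
(* [W^T (W + 1) = (W + 1)^T], so [det (W + 1)] equals its opposite. *)
have /det0P[v v0] : \det (W + 1%:M) == 0.
  have : \det (W^T *m (W + 1%:M)) = \det (W + 1%:M).
    by rewrite mulmxDr oW mulmx1 -[RHS]det_tr linearD/= trmx1 addrC.
  by rewrite det_mulmx det_tr dW => ?; apply/eqP; lra.
rewrite mulmxDr mulmx1 => /eqP; rewrite addr_eq0 => /eqP vW.
have vWT : v *m W^T = - v.
  by rewrite -[v in LHS]opprK -vW mulNmx -mulmxA (mulmx1C oW) mulmx1.
pose Q := W^T + (2 / sqnorm v) *: (v^T *m v).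
have oQ : orthogonal_mx Q.
  have WvT : W *m v^T = - v^T by rewrite -[W]trmxK -trmx_mul vWT linearN.
  have QT : Q^T = W + (2 / sqnorm v) *: (v^T *m v).
    by rewrite /Q raddfD/= linearZ/= trmx_mul !trmxK.
  rewrite /orthogonal_mx QT /Q.
  rewrite mulmxDl !mulmxDr (mulmx1C oW) -!scalemxAl -!scalemxAr.
  rewrite mulmxA WvT -mulmxA vWT mulNmx mulmxN outer_outer !scalerA.
  rewrite -[_ * _ * sqnorm v]mulrA divfK ?sqnorm_eq0// mulr_natr mulr2n scalerDl !scalerN.
  by rewrite addKr subrK.
have := orthogonal_trace_le oQ.
rewrite /Q mxtraceD mxtrace_tr mxtraceZ trace_outer mulfVK ?sqnorm_eq0//; lra.
Qed.

End Reflections.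

Section SdiagTrace.
Variables (R : realType) (n : nat) (b : bool).
Implicit Types (a : 'I_n -> R) (W : 'M[R]_n).

Definition sdiag_entry a (j : 'I_n) : R := if j.+1 == n then (-1) ^+ b * a j else a j.

Lemma mxtrace_sdiag_mul a W : \tr (sdiag b a *m W) = \sum_j sdiag_entry a j * W j j.
Proof.
rewrite /mxtrace; apply: eq_bigr => j _.
by rewrite /sdiag mul_diag_mx !mxE.
Qed.

Lemma mxtrace_sdiag a : \tr (sdiag b a) = \sum_j sdiag_entry a j.
Proof. by rewrite mxtrace_diag; apply: eq_bigr => j _; rewrite mxE. Qed.

Lemma norm_sdiag_entry a j : 0 <= a j -> `|sdiag_entry a j| = a j.
Proof.
by move=> aj; rewrite /sdiag_entry; case: ifP; rewrite ?normrMsign ger0_norm.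
Qed.

End SdiagTrace.

Lemma sum_sdiag_entry1 (R : realType) n b :
  \sum_(j < n.+1) sdiag_entry b (fun=> 1) j = n.+1%:R - (2 * b%:R) :> R.
Proof.
rewrite big_ord_recr/= /sdiag_entry eqxx mulr1 (eq_bigr (fun=> 1)) => [|i _].
  rewrite sumr_const card_ord -[n.+1%:R]natr1; case: b; rewrite /= ?expr1 ?expr0; lra.
by rewrite /= eqSS ltn_eqF.
Qed.

(** The extreme case where all the entries have absolute value [1]: the sign
    matrix times [W] is orthogonal with determinant [(-1) ^ b]. *)
Lemma SO_sign_trace_le (R : realType) n b (W : 'M[R]_n.+1) :
  SO W ->
  \sum_(j < n.+1) sdiag_entry b (fun=> 1) j * W j j <= \sum_(j < n.+1) sdiag_entry b (fun=> 1) j.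
Proof.
move=> /SOP[oW dW]; rewrite sum_sdiag_entry1 -mxtrace_sdiag_mul.
pose J : 'M[R]_n.+1 := sdiag b (fun=> 1).
have J2 (j : 'I_n.+1) : sdiag_entry b (fun=> 1 : R) j * sdiag_entry b (fun=> 1) j = 1.
  by rewrite /sdiag_entry; case: ifP; rewrite ?mulr1// -expr2 sqrr_sign.
have oJ : orthogonal_mx J.
  rewrite /orthogonal_mx /J /sdiag tr_diag_mx mulmx_diag -diag_const_mx.
  by congr diag_mx; apply/rowP => j; rewrite !mxE; exact: J2.
have dJ : \det J = (-1) ^+ b.
  rewrite det_diag big_ord_recr/= big1 => [|i _]; rewrite mxE/=.
    by rewrite eqxx mul1r mulr1.
  by rewrite eqSS ltn_eqF.
have oJW := orthogonal_mxM oJ oW; rewrite -/J.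
move: dJ; case: b @J {J2} oJ oJW => J oJ oJW; rewrite ?expr1 => dJ.
  by rewrite mulr1; apply: orthogonal_trace_le_neg => //; rewrite det_mulmx dJ dW mulr1.
by rewrite mulr0 subr0; exact: orthogonal_trace_le.
Qed.

Lemma SO_diag1 (R : realType) n (W : 'M[R]_n.+1) :
  SO W -> (forall j, j != ord_max -> W j j = 1) -> W = 1%:M.
Proof.
move=> /SOP[oW dW] W1.
have Wd i j : i != j -> W i j = 0.
  have [->|ni] := eqVneq i ord_max => ij.
    have := orthogonal_mx_entry1 (orthogonal_mxT oW) (i := j) (j := j).
    by rewrite !mxE => /(_ (W1 _ _)) => /(_ _ ord_max); rewrite mxE => -> //; rewrite eq_sym.
  by apply: (orthogonal_mx_entry1 oW (W1 _ ni)); rewrite eq_sym.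
have We : W = diag_mx (\row_j W j j).
  apply/matrixP => i j; rewrite !mxE; case: eqVneq => [->|/Wd ->]; by rewrite ?mulr1n.
have Wm : W ord_max ord_max = 1.
  rewrite -dW We det_diag big_ord_recr/= big1 => [|i _]; rewrite !mxE.
    by rewrite mul1r eqxx mulr1n.
  by apply: W1; rewrite -val_eqE/= ltn_eqF.
apply/matrixP => i j; rewrite mxE; have [<-|/Wd//] := eqVneq i j.
by have [->|/W1] := eqVneq i ord_max.
Qed.

(** With [c] the last entry of [a], the [j]-th diagonal entry of [sdiag b a] is
    [(a j - c) + c * (sign of j)].  The first part is a nonnegative combination of
    the entries [W j j <= 1], with positive coefficients except for the last [j],
    and the second part is [SO_sign_trace_le].  Equality thus makes every
    diagonal entry but the last equal to [1], and the determinant fixes the last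
    one. *)
Lemma SO_trace_sdiag_max (R : realType) n b (a : 'I_n -> R) (W : 'M[R]_n)
    (a_decr : forall i j : 'I_n, (i < j)%N -> a j < a i)
    (a_ge0 : forall i, 0 <= a i) : SO W ->
  \tr (sdiag b a *m W) <= \tr (sdiag b a) /\
  (\tr (sdiag b a *m W) = \tr (sdiag b a) -> W = 1%:M).
Proof.
case: n a W a_decr a_ge0 => [|n] a W a_decr a_ge0 SOW.
  by rewrite [W]flatmx0 [in LHS]flatmx0 mulmx0 mxtrace0 [sdiag _ _]flatmx0 mxtrace0 flatmx0.
have [oW _] := (SOP _).1 SOW.
rewrite mxtrace_sdiag_mul mxtrace_sdiag; set c := a ord_max.
have entryE j : sdiag_entry b a j = (a j - c) + c * sdiag_entry b (fun=> 1) j.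
  rewrite /sdiag_entry; have [jn|_] := eqVneq j.+1 n.+1; last by rewrite mulr1 subrK.
  have -> : j = ord_max by apply/val_inj; case: jn.
  by rewrite subrr add0r mulr1 mulrC.
under eq_bigr do rewrite entryE mulrDl -mulrA.
under [X in _ <= X]eq_bigr do rewrite entryE.
under [in X in _ /\ (_ = X -> _)]eq_bigr do rewrite entryE.
rewrite !big_split/= -!mulr_sumr.
have ac j : 0 <= a j - c.
  have [->|jm] := eqVneq j ord_max; first by rewrite subrr.
  by rewrite subr_ge0 ltW// a_decr// ltn_ord_max.
have le1 j : 0 <= (a j - c) - (a j - c) * W j j.
  by rewrite subr_ge0 ler_piMr// orthogonal_mx_entry_le1.
have le2 : c * \sum_(j < n.+1) sdiag_entry b (fun=> 1) j * W j j <=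
             c * \sum_(j < n.+1) sdiag_entry b (fun=> 1) j.
  by rewrite ler_wpM2l// ?a_ge0//; exact: SO_sign_trace_le.
have le3 : 0 <= \sum_j ((a j - c) - (a j - c) * W j j) by exact: sumr_ge0.
rewrite sumrB big_split/= in le3; split; first lra.
move=> e; apply: SO_diag1 => // j jm.
have /eqP : \sum_j ((a j - c) - (a j - c) * W j j) = 0.
  by apply/eqP; rewrite eq_le (sumr_ge0 _ (fun j _ => le1 j)) andbT sumrB big_split/=; lra.
rewrite psumr_eq0// => /allP /(_ j (mem_index_enum _)) /=.
rewrite -{1}[a j - c]mulr1 -mulrBr mulf_eq0 subr_eq0 => /orP[|]; last first.
  by rewrite subr_eq0 => /eqP <-.
by rewrite gt_eqF// a_decr// ltn_ord_max.
Qed.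

(** * Householder reflections *)

(** Factor [[1, y; x^T, 1]] as a product of block triangular matrices in two
    ways. *)
Lemma det_1_sub_outer (R : comNzRingType) n (x y : 'rV[R]_n) :
  \det (1%:M - x^T *m y) = 1 - (y *m x^T) 0 0.
Proof.
pose M := block_mx 1%:M y x^T 1%:M.
have -> : \det (1%:M - x^T *m y) = \det M.
  have -> : M = block_mx 1%:M 0 x^T 1%:M *m block_mx 1%:M y 0 (1%:M - x^T *m y).
    rewrite mulmx_block ?mul1mx ?mulmx1 ?mul0mx ?mulmx0 ?addr0.
    by rewrite addrC subrK.
  by rewrite det_mulmx det_lblock det_ublock !det1 !mul1r.
have -> : M = block_mx 1%:M y 0 1%:M *m block_mx (1%:M - y *m x^T) 0 x^T 1%:M.
  by rewrite mulmx_block ?mul1mx ?mulmx1 ?mul0mx ?mulmx0 ?add0r subrK.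
rewrite det_mulmx det_lblock det_ublock !det1 !mul1r mulr1.
by rewrite det_mx11 !mxE.
Qed.

Section Householder.
Variables (R : realType) (n : nat).
Implicit Types u v x y : 'rV[R]_n.

Definition householder v : 'M[R]_n := 1%:M - (2 / sqnorm v) *: (v^T *m v).

Lemma mul_row_householder x v :
  x *m householder v = x - (2 / sqnorm v * (x *m v^T) 0 0) *: v.
Proof.
rewrite mulmxBr mulmx1 -scalemxAr mulmxA.
by rewrite [in LHS](mx11_scalar (x *m v^T)) mul_scalar_mx scalerA.
Qed.

Lemma householderT v : (householder v)^T = householder v.
Proof. by rewrite /householder linearB/= trmx1 linearZ/= trmx_mul trmxK. Qed.

Lemma householderK v : householder v *m householder v = 1%:M.
Proof.
have [->|v0] := eqVneq v 0.
  by rewrite /householder trmx0 mul0mx scaler0 subr0 mulmx1.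
rewrite [X in X *m _]/householder mulmxBl mul1mx.
suff -> : (2 / sqnorm v) *: (v^T *m v) *m householder v
          = - ((2 / sqnorm v) *: (v^T *m v)) by rewrite opprK subrK.
rewrite -scalemxAl -mulmxA mul_row_householder mul_row_tr mxE eqxx mulr1n.
rewrite divfK ?sqnorm_eq0// scaler_nat mulr2n opprD addrA subrr sub0r.
by rewrite mulmxN scalerN.
Qed.

Lemma orthogonal_householder v : orthogonal_mx (householder v).
Proof. by rewrite /orthogonal_mx householderT householderK. Qed.

Lemma det_householder v : v != 0 -> \det (householder v) = -1.
Proof.
move=> v0; rewrite /householder scalemxAr det_1_sub_outer -scalemxAl mul_row_tr.
by rewrite !mxE eqxx mulr1n divfK ?sqnorm_eq0//; lra.
Qed.

(** The reflection in the mediating hyperplane of two vectors of equal norm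
    exchanges them. *)
Lemma householder_swap x y : sqnorm x = sqnorm y -> x != y ->
  x *m householder (x - y) = y.
Proof.
move=> nxy xy; rewrite mul_row_householder.
have v0 : sqnorm (x - y) != 0 by rewrite sqnorm_eq0 subr_eq0.
suff -> : (x *m (x - y)^T) 0 0 = sqnorm (x - y) / 2.
  by rewrite mulrA divfK// divff// scale1r opprB addrC subrK.
apply: (canRL (mulfK _)); first by [].
have : sqnorm (x - y) + (sqnorm x - sqnorm y) = (x *m (x - y)^T) 0 0 * 2.
  rewrite mxE mulr_suml /sqnorm -sumrB -big_split/=.
  by apply: eq_bigr => j _; rewrite !mxE; ring.
by rewrite nxy subrr addr0.
Qed.

Lemma delta_householder (j : 'I_n) v :
  v 0 j = 0 -> delta_mx 0 j *m householder v = delta_mx 0 j :> 'rV_n.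
Proof.
move=> vj; rewrite mul_row_householder -rowE !mxE vj mulr0 scale0r subr0 //.
Qed.

End Householder.

(** * Path connectedness of the special orthogonal group *)

Section EntrywiseContinuity.
Variable R : realType.

Definition entrywise_continuous m n (f : R -> 'M[R]_(m, n)) :=
  forall i j, continuous (fun t => f t i j).

Lemma entrywise_continuousP m n (f : R -> 'M[R]_(m, n)) :
  entrywise_continuous f -> continuous f.
Proof.
move=> cf t A [B nB sBA].
have : \forall s \near t, forall i j, B i j (f s i j).
  apply: (@filter_forall _ _ (fun i s => forall j, B i j (f s i j)) (nbhs t) _) => i.
  apply: (@filter_forall _ _ (fun j s => B i j (f s i j)) (nbhs t) _) => j.
  exact: (cf i j t _ (nB i j)).
by apply: filterS => s; exact: sBA.
Qed.

Lemma continuous_sum (I : finType) (f : I -> R -> R) :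
  (forall i, continuous (f i)) -> continuous (fun t => \sum_i f i t).
Proof.
move=> cf; apply: continuous_big => [|i _]; [exact: add_continuous|exact: cf].
Qed.

Lemma entrywise_continuousM m n p (f : R -> 'M[R]_(m, n)) (g : R -> 'M[R]_(n, p)) :
  entrywise_continuous f -> entrywise_continuous g ->
  entrywise_continuous (fun t => f t *m g t).
Proof.
move=> cf cg i j.
have -> : (fun t => (f t *m g t) i j) = fun t => \sum_k f t i k * g t k j.
  by apply/funext => t; rewrite mxE.
by apply: continuous_sum => k t; apply: cvgM; [exact: cf|exact: cg].
Qed.

Lemma entrywise_continuous_cst m n (A : 'M[R]_(m, n)) :
  entrywise_continuous (fun=> A).
Proof. by move=> i j t; exact: cvg_cst. Qed.

Lemma entrywise_continuousT m n (f : R -> 'M[R]_(m, n)) :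
  entrywise_continuous f -> entrywise_continuous (fun t => (f t)^T).
Proof.
move=> cf i j; have -> : (fun t => (f t)^T i j) = fun t => f t j i.
  by apply/funext => t; rewrite mxE.
exact: cf.
Qed.

Lemma entrywise_continuous_householder n (f : R -> 'rV[R]_n) :
  (forall t, f t != 0) -> entrywise_continuous f ->
  entrywise_continuous (fun t => householder (f t)).
Proof.
move=> f0 cf i j.
have -> : (fun t => householder (f t) i j) =
    fun t => (i == j)%:R - 2 / (\sum_k f t 0 k * f t 0 k) * (f t 0 i * f t 0 j).
  by apply/funext => t; rewrite !mxE big_ord1 !mxE; congr (_ - _ / _ * _).
move=> t; apply: cvgB; first exact: cvg_cst.
apply: cvgM; last by apply: cvgM; exact: cf.
apply: cvgM; first exact: cvg_cst.
apply: cvgV.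
  by have := f0 t; rewrite -sqnorm_eq0 /sqnorm; congr (_ != _).
by apply: continuous_sum => k s; apply: cvgM; exact: cf.
Qed.

End EntrywiseContinuity.

(** The path is defined on the whole line, so that paths can be multiplied
    without restricting their continuity to the unit interval; multiplication
    replaces concatenation throughout. *)
Definition SO_path (R : realType) n (U : 'M[R]_n) :=
  exists f : R -> 'M[R]_n,
    [/\ entrywise_continuous f, f 0 = 1%:M, f 1 = U & forall t, SO (f t)].

Lemma SO_path1 (R : realType) n : SO_path (1%:M : 'M[R]_n).
Proof.
exists (fun=> 1%:M); split=> // [|_]; [exact: entrywise_continuous_cst|exact: SO1].
Qed.

Lemma SO_pathM (R : realType) n (U V : 'M[R]_n) :
  SO_path U -> SO_path V -> SO_path (U *m V).
Proof.
move=> [f [cf f0 f1 SOf]] [g [cg g0 g1 SOg]].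
exists (fun t => f t *m g t); split; rewrite ?f0 ?f1 ?g0 ?g1 ?mulmx1//.
  exact: entrywise_continuousM.
by move=> t; exact: SOM.
Qed.

Lemma SO_householder2 (R : realType) n (u v : 'rV[R]_n) :
  u != 0 -> v != 0 -> SO (householder u *m householder v).
Proof.
move=> u0 v0; apply/SOP; rewrite det_mulmx !det_householder// mulrNN mulr1.
by split=> //; apply: orthogonal_mxM; exact: orthogonal_householder.
Qed.

(** The reflection [householder v] depends only on the line spanned by [v].  If
    the affine line through [u] and [v] avoids the origin, move one vector along
    it to the other; otherwise [u] and [v] are proportional and the product is
    [1]. *)
Lemma SO_path_householder2 (R : realType) n (u v : 'rV[R]_n) :
  u != 0 -> v != 0 -> SO_path (householder u *m householder v).
Proof.
move=> u0 v0; pose w t : 'rV[R]_n := (1 - t) *: u + t *: v.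
have [[t wt]|w0] := pselect (exists t, w t = 0).
  have t0 : t != 0.
    apply/eqP => t0; move: wt u0; rewrite /w t0 subr0 scale1r scale0r addr0 => ->.
    by rewrite eqxx.
  have [c ve] : exists c, v = c *: u.
    exists (- (t^-1 * (1 - t))); move/eqP: wt; rewrite /w addrC addr_eq0 => /eqP tv.
    by rewrite scaleNr -scalerA -scalerN -tv scalerA mulVf// scale1r.
  have c0 : c != 0 by apply: contraNneq v0 => c0; rewrite ve c0 scale0r.
  suff -> : householder v = householder u by rewrite householderK; exact: SO_path1.
  have cT : (c *: u)^T = c *: u^T by rewrite linearZ.
  rewrite /householder ve cT -scalemxAl -scalemxAr !scalerA.
  congr (_ - _ *: _); rewrite -sqnorm_eq0 in u0.
  have -> : sqnorm (c *: u) = c ^+ 2 * sqnorm u.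
    by rewrite /sqnorm mulr_sumr; apply: eq_bigr => j _; rewrite mxE exprMn.
  by field; rewrite c0 u0.
have {}w0 t : w t != 0 by apply/eqP => wt; apply: w0; exists t.
exists (fun t => householder u *m householder (w t)); split.
- apply: entrywise_continuousM; first exact: entrywise_continuous_cst.
  apply: entrywise_continuous_householder => // i j.
  have -> : (fun t => w t i j) = fun t => (1 - t) * u i j + t * v i j.
    by apply/funext => t; rewrite !mxE.
  move=> t; apply: cvgD; apply: cvgM; try exact: cvg_cst; last exact: cvg_id.
  by apply: cvgB; [exact: cvg_cst|exact: cvg_id].
- by rewrite /w subr0 scale1r scale0r addr0 householderK.
- by rewrite /w subrr scale1r scale0r add0r.
- by move=> t; exact: SO_householder2.
Qed.

(** Induction on the number [k] of basis vectors, apart from the last one, that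
    [U] is not yet known to fix.  One reflection sends the row of index [i] of
    [U] to the basis vector [i]; the reflection in the last basis vector, which
    does not disturb the vectors fixed so far, restores the determinant. *)
Lemma SO_path_fixing (R : realType) n k i (U : 'M[R]_n.+1) :
  (i + k = n)%N -> SO U ->
  (forall j : 'I_n.+1, (j < i)%N -> row j U = delta_mx 0 j) -> SO_path U.
Proof.
elim: k i U => [|k IH] i U ikn SOU fixU.
  suff -> : U = 1%:M by exact: SO_path1.
  apply: SO_diag1 => // j /ltn_ord_max; rewrite -[X in (_ < X)%N]ikn addn0 => /fixU.
  by move=> /rowP /(_ j); rewrite !mxE !eqxx.
have ilt : (i < n)%N by rewrite -ikn addnS ltnS leq_addr.
pose i0 : 'I_n.+1 := inord i.
have i0E : i0 = i :> nat by rewrite inordK// ltnS ltnW.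
have [oU dU] := (SOP _).1 SOU.
have fixS (W : 'M[R]_n.+1) : (forall j : 'I__, (j < i)%N -> row j W = delta_mx 0 j) ->
    row i0 W = delta_mx 0 i0 ->
    forall j : 'I__, (j < i.+1)%N -> row j W = delta_mx 0 j.
  move=> fixW rW j; rewrite ltnS leq_eqVlt => /orP[/eqP ji|]; last exact: fixW.
  by have -> : j = i0 by apply: val_inj; rewrite /= i0E.
have [/(fixS _ fixU) fixU'|ne] := eqVneq (row i0 U) (delta_mx 0 i0).
  by apply: (IH i.+1) => //; rewrite addSnnS.
pose v := row i0 U - delta_mx 0 i0; pose e : 'rV[R]_n.+1 := delta_mx 0 ord_max.
have v0 : v != 0 by rewrite subr_eq0.
have e0 : e != 0.
  by apply/eqP => /rowP /(_ ord_max); rewrite !mxE !eqxx => /eqP; rewrite oner_eq0.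
have fix_e (j : 'I_n.+1) : (j < n)%N -> e 0 j = 0.
  by move=> jn; rewrite mxE eqxx -val_eqE/= ltn_eqF.
have -> : U = (U *m householder v *m householder e) *m (householder e *m householder v).
  rewrite -!mulmxA (mulmxA (householder e)) householderK mul1mx.
  by rewrite householderK mulmx1.
apply: SO_pathM; last exact: SO_path_householder2.
apply: (IH i.+1); first by rewrite addSnnS.
  by rewrite -mulmxA; apply: SOM => //; exact: SO_householder2.
apply: fixS => [j ji|].
  rewrite !row_mul fixU// delta_householder ?delta_householder ?fix_e//.
    exact: ltn_trans ji ilt.
  rewrite !mxE -!val_eqE/= i0E (ltn_eqF ji) subr0.
  have Ujj : U^T j j = 1 by rewrite mxE; have /rowP/(_ j) := fixU j ji; rewrite !mxE !eqxx.
  have := orthogonal_mx_entry1 (orthogonal_mxT oU) Ujj (k := i0); rewrite mxE; apply.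
  by rewrite -val_eqE/= i0E gtn_eqF.
have nrm : sqnorm (row i0 U) = sqnorm (delta_mx 0 i0).
  rewrite [RHS](_ : _ = 1); last first.
    rewrite /sqnorm (bigD1 i0)//= mxE !eqxx expr1n big1 ?addr0// => j ji.
    by rewrite mxE (negbTE ji) andbF expr0n.
  by rewrite -(orthogonal_mx_row i0 oU); apply: eq_bigr => j _; rewrite mxE.
rewrite !row_mul (householder_swap nrm ne); apply: delta_householder.
by rewrite fix_e// i0E.
Qed.

Lemma SO_pathP (R : realType) n (U : 'M[R]_n) : SO U -> SO_path U.
Proof.
case: n U => [|n] U SOU; last exact: (@SO_path_fixing R n n 0).
have -> : U = 1%:M by apply/matrixP => -[].
exact: SO_path1.
Qed.

(** * Block diagonal matrices *)

Section BlockDiagonal.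
Variables (R : realType) (K : nat) (ns : 'I_K -> nat).
Implicit Types B C : forall i, 'M[R]_(ns i).
Notation sig1 := tagnat.sig1.

Lemma mulmx_mxdiag B C :
  \mxdiag_i B i *m \mxdiag_i C i = \mxdiag_i (B i *m C i).
Proof.
rewrite {2}/mxdiag mul_mxdiag_mxblock; apply/eq_mxblock => i j.
by case: eqVneq => [<-|_]; rewrite ?conform_mx_id ?mulmx0.
Qed.

Lemma mxdiagE_neq B s t : sig1 s != sig1 t -> (\mxdiag_i B i) s t = 0.
Proof. by move=> /negbTE st; rewrite mxE st mxE. Qed.

Lemma mxdiag_submxblock (M : 'M[R]_(\sum_i ns i)) :
  (forall s t, sig1 s != sig1 t -> M s t = 0) ->
  M = \mxdiag_i submxblock M i i.
Proof.
move=> M0; apply/mxblockP => i j; rewrite mxblockK.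
case: eqVneq => [<-|ij]; first by rewrite conform_mx_id.
by apply/matrixP => x y; rewrite !mxE M0// !tagnat.Rank1K.
Qed.

Lemma orthogonal_mxdiag B :
  orthogonal_mx (\mxdiag_i B i) <-> forall i, orthogonal_mx (B i).
Proof.
rewrite /orthogonal_mx tr_mxdiag mulmx_mxdiag -mxdiagZ.
by split=> [/eq_mxdiagP|oB]; [|exact: eq_mxdiag].
Qed.

Lemma mxdiag_scalar (p : 'I_K -> R) :
  \mxdiag_i ((p i)%:M : 'M[R]_(ns i)) = diag_mx (\row_s p (sig1 s)).
Proof.
under eq_mxdiag do rewrite -diag_const_mx.
by rewrite -diag_mxrow; congr diag_mx; apply/rowP => s; rewrite !mxE.
Qed.

End BlockDiagonal.

Lemma det_castmx (R : comNzRingType) m n (e : (m = n) * (m = n)) (M : 'M[R]_m) :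
  \det (castmx e M) = \det M.
Proof.
by case: e => e1 e2; rewrite (eq_irrelevance e2 e1); case: n / e1 {e2}; rewrite castmx_id.
Qed.

Lemma det_mxdiag (R : comNzRingType) K (ns : 'I_K -> nat)
    (B : forall i, 'M[R]_(ns i)) :
  \det (\mxdiag_i B i) = \prod_i \det (B i).
Proof.
elim: K ns B => [|K IH] ns B.
  rewrite [RHS]big_ord0; have e : (\sum_(i < 0) ns i = 0)%N by rewrite big_ord0.
  by rewrite -(det_castmx (e, e) (\mxdiag_i B i)) det_mx00.
by rewrite mxdiag_recl det_castmx det_ublock IH big_ord_recl.
Qed.

Lemma SO_mxdiag (R : realType) K (ns : 'I_K -> nat) (B : forall i, 'M[R]_(ns i)) :
  (forall i, SO (B i)) -> SO (\mxdiag_i B i).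
Proof.
move=> SOB; apply/SOP; split.
  by apply/orthogonal_mxdiag => i; have [] := (SOP _).1 (SOB i).
by rewrite det_mxdiag big1// => i _; have [] := (SOP _).1 (SOB i).
Qed.

Lemma entrywise_continuous_mxdiag (R : realType) K (ns : 'I_K -> nat)
    (f : forall i, R -> 'M[R]_(ns i)) :
  (forall i, entrywise_continuous (f i)) ->
  entrywise_continuous (fun t => \mxdiag_i f i t).
Proof.
move=> cf s t.
have [st|st] := eqVneq (tagnat.sig1 s) (tagnat.sig1 t); last first.
  rewrite (_ : (fun _ => _) = fun=> 0); first by move=> x; exact: cvg_cst.
  by apply/funext => x; exact: mxdiagE_neq.
rewrite -(tagnat.sig2K s) -(tagnat.sig2K t).
move: (tagnat.sig2 s) (tagnat.sig2 t); rewrite -st => x y.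
rewrite (_ : (fun _ => _) = fun r => f (tagnat.sig1 s) r x y); first exact: cf.
apply/funext => r; have := submxblock_diag (fun i => f i r) (tagnat.sig1 s).
by move=> /matrixP /(_ x y); rewrite mxE.
Qed.

Section SignFix.
Variables (R : realType) (K : nat) (ns : 'I_K -> nat).
Hypothesis ns_gt0 : forall i, (0 < ns i)%N.

(** Used for [d] equal to [1] or [-1], where this is a diagonal sign matrix. *)
Definition det_sign_mx n (d : R) : 'M[R]_n :=
  diag_mx (\row_(j < n) if j == 0 :> nat then d else 1).

Lemma det_det_sign_mx n d : (0 < n)%N -> \det (det_sign_mx n d) = d.
Proof.
case: n => // n _; rewrite det_diag big_ord_recl/= big1 => [|j _]; rewrite !mxE//.
by rewrite mulr1.
Qed.

Lemma det_sign_mxT n d : (det_sign_mx n d)^T = det_sign_mx n d.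
Proof. exact: tr_diag_mx. Qed.

Lemma orthogonal_det_sign_mx n d : d * d = 1 -> orthogonal_mx (det_sign_mx n d).
Proof.
move=> d2; rewrite /orthogonal_mx det_sign_mxT /det_sign_mx mulmx_diag -diag_const_mx.
by congr diag_mx; apply/rowP => j; rewrite !mxE; case: ifP; rewrite ?mulr1.
Qed.

(** Diagonal sign matrices commute with the diagonal matrix [A] and square to
    [1], so inserting them on both sides of [A] leaves the product unchanged
    while correcting the determinants of the orthogonal blocks. *)
Lemma SO_blocks_sign_fix (U V : forall i, 'M[R]_(ns i)) (A : 'M[R]_(\sum_i ns i)) :
  is_diag_mx A ->
  (forall i, orthogonal_mx (U i)) -> (forall i, orthogonal_mx (V i)) ->
  (forall i, \det (V i) = \det (U i)) ->
  exists S : forall i, 'M[R]_(ns i),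
  [/\ forall i, (S i)^T = S i, forall i, SO (U i *m S i), forall i, SO (S i *m V i) &
   \mxdiag_i (U i *m S i) *m A *m \mxdiag_i (S i *m V i) =
   \mxdiag_i U i *m A *m \mxdiag_i V i].
Proof.
move=> /diag_mxP[a ->] oU oV dUV.
pose S i := det_sign_mx (ns i) (\det (U i)).
have oS i : orthogonal_mx (S i).
  by apply: orthogonal_det_sign_mx; exact: det_orthogonal_mx.
have ST i : (S i)^T = S i by exact: det_sign_mxT.
have dS i : \det (S i) = \det (U i) by exact: det_det_sign_mx.
exists S; split=> // [i|i|].
- by apply/SOP; split; [exact: orthogonal_mxM|rewrite det_mulmx dS det_orthogonal_mx].
- apply/SOP; split; first exact: orthogonal_mxM.
  by rewrite det_mulmx dS dUV det_orthogonal_mx.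
rewrite -!mulmx_mxdiag.
suff SAS : \mxdiag_i S i *m diag_mx a *m \mxdiag_i S i = diag_mx a.
  by rewrite -[in RHS]SAS !mulmxA.
have -> : \mxdiag_i S i *m diag_mx a = diag_mx a *m \mxdiag_i S i.
  by rewrite /S /det_sign_mx -diag_mxrow diag_mxC.
rewrite -mulmxA mulmx_mxdiag; under eq_mxdiag do rewrite -[X in X *m _]ST (oS _).
by rewrite mxdiagZ mulmx1.
Qed.

End SignFix.

(** * The maximizers *)

Section Maximizers.
Variables (R : realType) (k : nat) (ns : 'I_k.+1 -> nat).
Notation n := (\sum_(i < k.+1) ns i)%N.
Variables (p : 'I_k.+1 -> R) (a : 'I_n -> R) (b : bool).
Hypothesis ns_gt0 : forall i, (0 < ns i)%N.
Hypothesis p_decr : forall i j : 'I_k.+1, (i < j)%N -> p j < p i.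
Hypothesis p_ge0 : 0 <= p ord_max.
Hypothesis a_decr : forall i j : 'I_n, (i < j)%N -> a j < a i.
Hypothesis a_ge0 : forall i, 0 <= a i.

Let A := sdiag b a.
Let P : 'M[R]_n := \mxdiag_(i < k.+1) (p i)%:M.
Notation sig1 := tagnat.sig1.

Lemma p_gt_last i : i != ord_max -> p ord_max < p i.
Proof. by move=> im; apply: p_decr; exact: ltn_ord_max. Qed.

Lemma p_inj : injective p.
Proof.
move=> i j pij; apply/val_inj; case: (ltngtP i j) => // /p_decr.
  by rewrite pij ltxx.
by rewrite pij ltxx.
Qed.

Let w (s : 'I_n) := p (sig1 s) - p ord_max.

Let w_eq0 s : (w s == 0) = (sig1 s == ord_max).
Proof. by rewrite subr_eq0; apply/eqP/eqP => [/p_inj|->]. Qed.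

Let w_ge0 s : 0 <= w s.
Proof.
have [e|/p_gt_last ?] := eqVneq (sig1 s) ord_max; first by rewrite /w e subrr.
by rewrite subr_ge0 ltW.
Qed.

Let w_decr (s t : 'I_n) : (s <= t)%N -> w t <= w s.
Proof.
move=> st; rewrite lerB//.
have := tagnat.le_sig1 st; rewrite leEord leq_eqVlt => /orP[/eqP/val_inj->//|].
by move=> /p_decr /ltW.
Qed.

(* A nonzero lowered weight puts [s] outside the last block, hence before the
   last index, the only one whose entry may vanish or be negative. *)
Let sdiag_entry_gt0 s : w s != 0 -> 0 < sdiag_entry b a s.
Proof.
rewrite w_eq0 => s_last; pose r : 'I_n := tagnat.Rank ord_max (Ordinal (ns_gt0 ord_max)).
have sr : (s < r)%N.
  rewrite ltnNge; apply: contra s_last => rs.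
  have := tagnat.le_sig1 rs; rewrite tagnat.Rank1K leEord => h.
  by apply/eqP/val_inj/eqP; rewrite /= eqn_leq leq_ord.
rewrite /sdiag_entry ltn_eqF; last exact: leq_ltn_trans sr (ltn_ord r).
exact: le_lt_trans (a_ge0 r) (a_decr sr).
Qed.

Let trace_weighted U V :
  \tr ((P - (p ord_max)%:M) *m (U *m A *m V)) =
  \sum_s \sum_j w s * sdiag_entry b a j * (U s j * V j s).
Proof.
rewrite /P mxdiag_scalar -diag_const_mx -linearB/= /mxtrace.
apply: eq_bigr => s _; rewrite mul_diag_mx !mxE mulr_sumr.
by apply: eq_bigr => j _; rewrite /A /sdiag mul_mx_diag !mxE /w -!mulrA (mulrCA (U s j)).
Qed.

Let trace_weighted_A :
  \tr ((P - (p ord_max)%:M) *m A) = \sum_s w s * sdiag_entry b a s.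
Proof.
rewrite /P mxdiag_scalar -diag_const_mx -linearB/= mulmx_diag mxtrace_diag.
by apply: eq_bigr => s _; rewrite !mxE.
Qed.

Let trace_split (B : 'M[R]_n) :
  \tr (P *m B) = \tr ((P - (p ord_max)%:M) *m B) + p ord_max * \tr B.
Proof. by rewrite mulmxBl mul_scalar_mx linearB/= linearZ/= subrK. Qed.

Let trace_cyclic (U V : 'M[R]_n) : \tr (U *m A *m V) = \tr (A *m (V *m U)).
Proof. by rewrite mxtrace_mulC (mulmxA V) [LHS]mxtrace_mulC. Qed.

Lemma trace_orbit_le (U V : 'M[R]_n) : SO U -> SO V -> \tr (P *m (U *m A *m V)) <= \tr (P *m A).
Proof.
move=> SOU SOV; rewrite !trace_split trace_weighted trace_weighted_A trace_cyclic.
have [[oU _] [oV _]] := ((SOP _).1 SOU, (SOP _).1 SOV).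
apply: lerD.
  by have [] := weighted_trace_max w_ge0 w_decr a_decr
    (fun i => norm_sdiag_entry b (a_ge0 i)) sdiag_entry_gt0 oU oV.
apply: ler_wpM2l => //.
by have [] := SO_trace_sdiag_max b a_decr a_ge0 (SOM SOV SOU).
Qed.

(** Since both summands of the trace are bounded by their values at the identity,
    equality holds in each of them.  The first one gives everything except the
    last block, where the lowered weight vanishes; if [p ord_max != 0], the second
    one gives [V *m U = 1]. *)
Lemma trace_orbit_max (U V : 'M[R]_n) : SO U -> SO V -> 
  \tr (P *m (U *m A *m V)) = \tr (P *m A) ->
  [/\ forall s t, sig1 s != sig1 t -> U s t = 0,
      forall s t, sig1 s != sig1 t -> V s t = 0 &
      forall s t, p (sig1 s) != 0 -> V t s = U s t].
Proof.
move=> SOU SOV; rewrite !trace_split trace_weighted trace_weighted_A trace_cyclic.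
have [[oU _] [oV _]] := ((SOP _).1 SOU, (SOP _).1 SOV).
have [le1 eq1] := weighted_trace_max w_ge0 w_decr a_decr
    (fun i => norm_sdiag_entry b (a_ge0 i)) sdiag_entry_gt0 oU oV.
have [le2 eq2] := SO_trace_sdiag_max b a_decr a_ge0 (SOM SOV SOU).
move=> e.
have le3 : p ord_max * \tr (A *m (V *m U)) <= p ord_max * \tr A.
  exact: ler_wpM2l.
have {}eq1 := eq1 ltac:(lra).
have w_neq s t : sig1 s != sig1 t -> w s != w t.
  by apply: contra => /eqP/addIr/p_inj ->.
split=> [s t /w_neq st|s t|s t ps].
- by have [/(_ st)[]] := eq1 s t.
- by rewrite eq_sym => /w_neq ts; have [/(_ ts)[]] := eq1 t s.
have [s_last|s_nlast] := eqVneq (w s) 0; last by have [_ /(_ s_nlast)] := eq1 s t.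
have p0 : p ord_max != 0 by move/eqP: s_last ps; rewrite w_eq0 => /eqP ->.
have VU : V *m U = 1%:M.
  apply: eq2; have e' : p ord_max * \tr (A *m (V *m U)) = p ord_max * \tr A by lra.
  exact: (mulfI p0).
have -> : V = U^T.
  by rewrite -[V]mulmx1 -(mulmx1C oU) mulmxA VU mul1mx.
by rewrite mxE.
Qed.

Lemma rmaxE : rmax P A = \tr (P *m A).
Proof.
rewrite /rmax /set_max; set S := [set _ | _].
have ubS : ubound S (\tr (P *m A)).
  move=> x [U [V [SOU SOV ->]]].
  by rewrite -!mulmxA (mulmxA U); exact: trace_orbit_le.
have inS : S (\tr (P *m A)).
  by exists 1%:M, 1%:M; split; rewrite ?mulmx1//; exact: SO1.
case: xgetP => [x _ [Sx ubx]|/(_ (\tr (P *m A)))]; last by case.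
by apply/eqP; rewrite eq_le ubS// ubx.
Qed.

(** The two cases of the theorem in one formula: for [i] other than [ord_max]
    the value [p i] is positive, so only the last pair of blocks can be
    independent. *)
Lemma GP_blocks :
  GP P A = [set B | exists U V : forall i, 'M[R]_(ns i),
    [/\ forall i, SO (U i), forall i, SO (V i),
        forall i, p i != 0 -> V i = (U i)^T &
        B = \mxdiag_(i < k.+1) U i *m A *m \mxdiag_(i < k.+1) V i]].
Proof.
apply/seteqP; split=> B; last first.
  move=> [U [V [SOU SOV UV ->]]]; rewrite /GP /= rmaxE; split.
    by exists (\mxdiag_i U i), (\mxdiag_i V i); split=> //; exact: SO_mxdiag.
  rewrite mulmxA mxtrace_mulC !mulmxA; congr (\tr (_ *m _)).
  rewrite /P !mulmx_mxdiag; apply: eq_mxdiag => i.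
  have [->|/UV ->] := eqVneq (p i) 0; first by rewrite -scalemx1 scale0r mulmx0 mul0mx.
  have [oU _] := (SOP _).1 (SOU i).
  by rewrite mul_mx_scalar -scalemxAl oU scalemx1.
move=> [[U [V [SOU SOV ->]]]]; rewrite rmaxE => /(trace_orbit_max SOU SOV)[].
move=> /mxdiag_submxblock; set Ub := fun i => submxblock U i i => UE.
move=> /mxdiag_submxblock; set Vb := fun i => submxblock V i i => VE UV.
have UVb i : p i != 0 -> Vb i = (Ub i)^T.
  by move=> pi; apply/matrixP => x y; rewrite !mxE UV// tagnat.Rank1K.
have {SOU} [+ dU] := (SOP _).1 SOU; rewrite UE => /orthogonal_mxdiag oU.
have {SOV} [+ dV] := (SOP _).1 SOV; rewrite VE => /orthogonal_mxdiag oV.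
(* On the last block [Vb] need not be the transpose of [Ub], but the products of
   all the block determinants are both [1] and the other factors agree. *)
have dUV i : \det (Vb i) = \det (Ub i).
  have dUV' j : j != ord_max -> \det (Vb j) = \det (Ub j).
    by move=> /p_gt_last pj; rewrite UVb ?det_tr// gt_eqF// (le_lt_trans p_ge0).
  have [->|/dUV'//] := eqVneq i ord_max.
  have := etrans dV (esym dU); rewrite UE VE !det_mxdiag.
  rewrite [in LHS](bigD1 ord_max)//= [in RHS](bigD1 ord_max)//=.
  rewrite (eq_bigr _ dUV') => /mulIf; apply.
  apply/prodf_neq0 => j _; apply/eqP => d0.
  by have := det_orthogonal_mx (oU j); rewrite d0 mul0r => /eqP; rewrite eq_sym oner_eq0.
have dA : is_diag_mx A by exact: diag_mx_is_diag.
have [S [ST SOU SOV <-]] := SO_blocks_sign_fix ns_gt0 dA oU oV dUV.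
exists (fun i => Ub i *m S i), (fun i => S i *m Vb i); split=> // i pi.
by rewrite UVb// trmx_mul ST.
Qed.

(** The path is taken block by block in [SO (ns i)]; where [p i != 0] the path
    of [V i] is the transpose of that of [U i], which keeps it inside the
    parametrization of [GP_blocks]. *)
Lemma path_connected_GP : path_connected R (GP P A).
Proof.
rewrite GP_blocks => _ _ [U [V [SOU SOV UV ->]]] [U' [V' [SOU' SOV' UV' ->]]].
have pathU i := cid (SO_pathP (SOM (SOT (SOU i)) (SOU' i))).
have pathV i := cid (SO_pathP (SOM (SOT (SOV i)) (SOV' i))).
pose f i t := U i *m projT1 (pathU i) t.
pose g i t := if p i == 0 then V i *m projT1 (pathV i) t else (f i t)^T.
have mulKT m (X Y : 'M[R]_m) : SO X -> X *m (X^T *m Y) = Y.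
  by move=> [_ XX _]; rewrite mulmxA XX mul1mx.
have f0 i : f i 0 = U i by rewrite /f; case: (pathU i) => h /= [_ -> _ _]; rewrite mulmx1.
have f1 i : f i 1 = U' i by rewrite /f; case: (pathU i) => h /= [_ _ -> _]; rewrite mulKT.
have SOf i t : SO (f i t).
  by rewrite /f; case: (pathU i) => h /= [_ _ _ SOh]; exact: SOM.
have cf i : entrywise_continuous (f i).
  rewrite /f; case: (pathU i) => h /= [ch _ _ _].
  by apply: entrywise_continuousM => //; exact: entrywise_continuous_cst.
have g0 i : g i 0 = V i.
  rewrite /g; case: eqP => [_|/eqP/UV ->]; last by rewrite f0.
  by case: (pathV i) => h /= [_ -> _ _]; rewrite mulmx1.
have g1 i : g i 1 = V' i.
  rewrite /g; case: eqP => [_|/eqP/UV' ->]; last by rewrite f1.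
  by case: (pathV i) => h /= [_ _ -> _]; rewrite mulKT.
have SOg i t : SO (g i t).
  rewrite /g; case: eqP => _; last exact: SOT.
  by case: (pathV i) => h /= [_ _ _ SOh]; exact: SOM.
have cg i : entrywise_continuous (g i).
  rewrite /g; case: eqP => _; last exact: entrywise_continuousT.
  case: (pathV i) => h /= [ch _ _ _].
  by apply: entrywise_continuousM => //; exact: entrywise_continuous_cst.
exists (fun t => \mxdiag_i f i t *m A *m \mxdiag_i g i t); split.
- apply: continuous_subspaceT; apply: entrywise_continuousP.
  apply: entrywise_continuousM; last exact: entrywise_continuous_mxdiag.
  apply: entrywise_continuousM; last exact: entrywise_continuous_cst.
  exact: entrywise_continuous_mxdiag.
- by rewrite (eq_mxdiag f0) (eq_mxdiag g0).
- by rewrite (eq_mxdiag f1) (eq_mxdiag g1).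
move=> t _; exists (fun i => f i t), (fun i => g i t); split=> // i pi.
by rewrite /g (negbTE pi).
Qed.

End Maximizers.

(* The blocks are indexed by 'I_k.+1, so k.+1 >= 1 is the paper's k and
   p ord_max its p_k; the matrix size is n = \sum_i ns i. *)
Theorem theorem3p4 (R : realType) (k : nat) (ns : 'I_k.+1 -> nat)
    (p : 'I_k.+1 -> R) (a : 'I_(\sum_(i < k.+1) ns i) -> R) (b : bool)
    (ns_gt0 : forall i, (0 < ns i)%N)
    (p_decr : forall i j : 'I_k.+1, (i < j)%N -> p j < p i)
    (p_ge0 : 0 <= p ord_max)
    (a_decr : forall i j : 'I_(\sum_(i < k.+1) ns i), (i < j)%N -> a j < a i)
    (a_ge0 : forall i, 0 <= a i) :
  let A := sdiag b a in
  let P : 'M[R]_(\sum_(i < k.+1) ns i) := \mxdiag_(i < k.+1) (p i)%:M in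
  [/\ 0 < p ord_max ->
      GP P A =
        [set B | exists U : forall i, 'M[R]_(ns i),
          (forall i, SO (U i)) /\
          B = (\mxdiag_(i < k.+1) U i) *m A *m (\mxdiag_(i < k.+1) (U i)^T)],
      p ord_max = 0 ->
      GP P A =
        [set B | exists U V : forall i, 'M[R]_(ns i),
          [/\ forall i, SO (U i),
              SO (V ord_max),
              forall i, i != ord_max -> V i = (U i)^T &
              B = (\mxdiag_(i < k.+1) U i) *m A *m (\mxdiag_(i < k.+1) V i)]]
    & path_connected R (GP P A)].
Proof.
move=> A P.
have GPE := GP_blocks b ns_gt0 p_decr p_ge0 a_decr a_ge0.
have p_gt0 i : i != ord_max -> p i != 0.
  by move=> /(p_gt_last p_decr) pi; rewrite gt_eqF// (le_lt_trans p_ge0).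
split=> [p_last|p_last|]; last exact: path_connected_GP.
- rewrite GPE; apply/seteqP; split=> B.
    move=> [U [V [SOU SOV UV ->]]]; exists U; split=> //.
    congr (_ *m _); apply: eq_mxdiag => i; apply: UV.
    by have [->|/p_gt0//] := eqVneq i ord_max; rewrite gt_eqF.
  move=> [U [SOU ->]]; exists U, (fun i => (U i)^T); split=> // i; exact: SOT.
- rewrite GPE; apply/seteqP; split=> B.
    move=> [U [V [SOU SOV UV ->]]]; exists U, V; split=> // i /p_gt0; exact: UV.
  move=> [U [V [SOU SOV UV ->]]]; exists U, V; split=> // i.
    by have [->//|/UV ->] := eqVneq i ord_max; exact: SOT.
  by have [->|/UV//] := eqVneq i ord_max; rewrite p_last eqxx.
Qed.
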